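(* Let $p$ be a prime, $G=\langle g\rangle$ a cyclic group of order $p$, $L=\mathbb{Z}_pG$, and let $A$ be an infinite $\mathbb{Z}_pG$-module of rank $1$. Then the following hold. (i) If $A$ has no $p$-torsion, then $A\cong L$, $A\cong\mathfrak{I}_G$, or $A\cong\mathbb{Z}_p$ (on which $G$ acts trivially). (ii) If $A$ has non-trivial $p$-torsion, then either $A\cong L/p^nL^G$ or $A\cong L/(g-1)^n\mathfrak{I}_G$, where $p^n$ is the order of the torsion part of $A$.
   Context: $\mathbb{Z}_p$ is the ring of $p$-adic integers. A $\mathbb{Z}_pG$-module ''of rank $1$'' means a cyclic $\mathbb{Z}_pG$-module, i.e. one isomorphic to a quotient of $\mathbb{Z}_pG$. $\mathfrak{I}_G$ is the augmentation ideal of $\mathbb{Z}_pG$, and $L^G$ is the submodule of $G$-fixed elements of $L$. The torsion part of $A$ is $T(A)=\{a\in A\mid p^l a=0\text{ for some integer } l>0\}$. All isomorphisms are of $\mathbb{Z}_pG$-modules. *)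

(* Defs.v *)
From HB Require Import structures.
From mathcomp Require Import all_boot all_order all_algebra all_fingroup.
From mathcomp Require Import generic_quotient ring_quotient.
From mathcomp Require Import mathcomp_extra boolp classical_sets functions cardinality.

Set Implicit Arguments.
Unset Strict Implicit.
Unset Printing Implicit Defensive.

Import Order.TTheory GRing.Theory Num.Theory.
Local Open Scope ring_scope.

(* The p-adic integers, as the inverse limit of the rings Z/p^n: the n-th
   component is the canonical representative (_ %% p ^ n)%Z, and the transition
   map Z/p^n.+1 -> Z/p^n is reduction modulo p^n.  Nothing here needs p to be
   prime, whence a possibly trivial ring (p = 1). *)
Section Padic.
Variable p : nat.
Local Notation q n := ((p ^ n)%N : int).

Definition padic_coherent : {pred nat -> int} :=
  [pred u : nat -> int | `[< forall n, (u n.+1 %% q n)%Z = u n >]].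

Record padic := Padic {
  padic_val :> nat -> int;
  padic_valP : padic_val \in padic_coherent }.

HB.instance Definition _ := [isSub for padic_val].
HB.instance Definition _ := [Choice of padic by <:].

Lemma padicP (x y : padic) : (forall n, x n = y n) -> x = y.
Proof. by move=> xy; apply: val_inj; apply: funext. Qed.

Lemma padicE (x : padic) n : (x n.+1 %% q n)%Z = x n.
Proof. by have /asboolP := padic_valP x. Qed.

Lemma modz_padic (m : int) n : ((m %% q n.+1)%Z %% q n)%Z = (m %% q n)%Z.
Proof.
by rewrite {2}(divz_eq m (q n.+1)) expnS PoszM mulrA modzMDl.
Qed.

Lemma padic_mod (x : padic) n : (x n %% q n)%Z = x n.
Proof. by rewrite -padicE modz_mod. Qed.

Fact padic_subproof (f : nat -> int) :
  (forall n, f n.+1 = f n %[mod q n])%Z ->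
  (fun n => (f n %% q n)%Z) \in padic_coherent.
Proof. by move=> fP; apply/asboolP => n; rewrite modz_padic fP. Qed.

Fact padic_const_subproof (m n : nat) : (m = m %[mod q n])%Z. Proof. by []. Qed.

Fact padic_add_subproof (x y : padic) n :
  (x n.+1 + y n.+1 = x n + y n %[mod q n])%Z.
Proof. by rewrite -modzDm !padicE. Qed.

Fact padic_opp_subproof (x : padic) n : (- x n.+1 = - x n %[mod q n])%Z.
Proof. by rewrite -modzNm padicE. Qed.

Fact padic_mul_subproof (x y : padic) n :
  (x n.+1 * y n.+1 = x n * y n %[mod q n])%Z.
Proof. by rewrite -modzMm !padicE. Qed.

Definition padic_zero := Padic (padic_subproof (padic_const_subproof 0)).
Definition padic_one := Padic (padic_subproof (padic_const_subproof 1)).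
Definition padic_add x y := Padic (padic_subproof (padic_add_subproof x y)).
Definition padic_opp x := Padic (padic_subproof (padic_opp_subproof x)).
Definition padic_mul x y := Padic (padic_subproof (padic_mul_subproof x y)).

Fact padic_addA : associative padic_add.
Proof. by move=> x y z; apply: padicP => n /=; rewrite modzDmr modzDml addrA. Qed.
Fact padic_addC : commutative padic_add.
Proof. by move=> x y; apply: padicP => n /=; rewrite addrC. Qed.
Fact padic_add0 : left_id padic_zero padic_add.
Proof. by move=> x; apply: padicP => n /=; rewrite modzDml add0r padic_mod. Qed.
Fact padic_addN : left_inverse padic_zero padic_opp padic_add.
Proof. by move=> x; apply: padicP => n /=; rewrite modzDml addNr. Qed.

HB.instance Definition _ :=
  GRing.isZmodule.Build padic padic_addA padic_addC padic_add0 padic_addN.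

Fact padic_mulA : associative padic_mul.
Proof. by move=> x y z; apply: padicP => n /=; rewrite modzMmr modzMml mulrA. Qed.
Fact padic_mulC : commutative padic_mul.
Proof. by move=> x y; apply: padicP => n /=; rewrite mulrC. Qed.
Fact padic_mul1 : left_id padic_one padic_mul.
Proof. by move=> x; apply: padicP => n /=; rewrite modzMml mul1r padic_mod. Qed.
Fact padic_mulD : left_distributive padic_mul +%R.
Proof.
by move=> x y z; apply: padicP => n /=; rewrite modzMml modzDm mulrDl.
Qed.

HB.instance Definition _ := GRing.Zmodule_isComPzRing.Build padic
  padic_mulA padic_mulC padic_mul1 padic_mulD.

End Padic.

(* The group ring R[G] for G = gT; the alias hides the pointwise product that
   MathComp puts on {ffun gT -> R}. *)
Section GroupRing.
Variables (R : pzRingType) (gT : finGroupType).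

Definition group_ring := {ffun gT -> R}.
HB.instance Definition _ := GRing.Zmodule.on group_ring.
Implicit Types a b c : group_ring.

Definition gr_one : group_ring := [ffun x => (x == 1%g)%:R].
Definition gr_mul a b : group_ring :=
  [ffun x => \sum_y a y * b (y^-1 * x)%g].

Fact gr_mulA : associative gr_mul.
Proof.
move=> a b c; apply/ffunP=> x; rewrite !ffunE.
under eq_bigr do rewrite ffunE mulr_sumr.
under [RHS]eq_bigr do rewrite ffunE mulr_suml.
rewrite [RHS]exchange_big /=; apply: eq_bigr => y _.
rewrite [RHS](reindex_inj (mulgI y)) /=; apply: eq_bigr => z _.
by rewrite mulrA mulKg invMg mulgA.
Qed.
Fact gr_mul1l : left_id gr_one gr_mul.
Proof.
move=> a; apply/ffunP=> x; rewrite ffunE (bigD1 1%g) //= big1 => [|y y1].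
  by rewrite ffunE eqxx mul1r invg1 mul1g addr0.
by rewrite ffunE (negPf y1) mul0r.
Qed.
Fact gr_mul1r : right_id gr_one gr_mul.
Proof.
move=> a; apply/ffunP=> x; rewrite ffunE (bigD1 x) //= big1 => [|y yx].
  by rewrite ffunE mulVg eqxx mulr1 addr0.
by rewrite ffunE -eq_mulVg1 (negPf yx) mulr0.
Qed.
Fact gr_mulDl : left_distributive gr_mul +%R.
Proof.
move=> a b c; apply/ffunP=> x; rewrite !ffunE -big_split /=.
by apply: eq_bigr => y _; rewrite ffunE mulrDl.
Qed.
Fact gr_mulDr : right_distributive gr_mul +%R.
Proof.
move=> a b c; apply/ffunP=> x; rewrite !ffunE -big_split /=.
by apply: eq_bigr => y _; rewrite ffunE mulrDr.
Qed.

HB.instance Definition _ := GRing.Zmodule_isPzRing.Build group_ring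
  gr_mulA gr_mul1l gr_mul1r gr_mulDl gr_mulDr.

Definition gr_scalar (r : R) : group_ring := [ffun x => if x == 1%g then r else 0].
Definition gr_elt (h : gT) : group_ring := [ffun x => (x == h)%:R].

Lemma gr_mulE a b x : (a * b) x = \sum_y a y * b (y^-1 * x)%g.
Proof. by rewrite [a * b]/(gr_mul a b) ffunE. Qed.

Lemma gr_scalarM r a x : (gr_scalar r * a) x = r * a x.
Proof.
rewrite gr_mulE (bigD1 1%g) //= big1 => [|y y1].
  by rewrite ffunE eqxx invg1 mul1g addr0.
by rewrite ffunE (negPf y1) mul0r.
Qed.

Lemma gr_eltM h a x : (gr_elt h * a) x = a (h^-1 * x)%g.
Proof.
rewrite gr_mulE (bigD1 h) //= big1 => [|y yh].
  by rewrite ffunE eqxx mul1r addr0.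
by rewrite ffunE (negPf yh) mul0r.
Qed.

Lemma gr_decomp a : a = \sum_h gr_scalar (a h) * gr_elt h.
Proof.
apply/ffunP => x; rewrite sum_ffunE (bigD1 x) //= big1 => [|y yx].
  by rewrite gr_scalarM ffunE eqxx mulr1 addr0.
by rewrite gr_scalarM ffunE eq_sym (negPf yx) mulr0.
Qed.

Lemma gr_elt_scalar h r : gr_elt h * gr_scalar r = gr_scalar r * gr_elt h.
Proof.
apply/ffunP => x; rewrite gr_eltM gr_scalarM !ffunE -eq_mulVg1 eq_sym.
by case: eqP => _; rewrite ?mulr1 ?mulr0.
Qed.

Definition aug a : R := \sum_x a x.

Fact aug_is_zmod_morphism : zmod_morphism aug.
Proof.
by move=> a b; rewrite /aug -sumrB; apply: eq_bigr => x _; rewrite !ffunE.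
Qed.
HB.instance Definition _ :=
  GRing.isZmodMorphism.Build group_ring R aug aug_is_zmod_morphism.

Fact aug_is_monoid_morphism : monoid_morphism aug.
Proof.
split=> [|a b]; rewrite /aug.
  rewrite (bigD1 1%g) //= big1 => [|y y1]; first by rewrite ffunE eqxx addr0.
  by rewrite ffunE (negPf y1).
under eq_bigr do rewrite gr_mulE.
rewrite exchange_big /= mulr_suml; apply: eq_bigr => y _.
by rewrite -mulr_sumr (reindex_inj (mulgI y)) /=; under eq_bigr do rewrite mulKg.
Qed.
HB.instance Definition _ :=
  GRing.isMonoidMorphism.Build group_ring R aug aug_is_monoid_morphism.

End GroupRing.

Lemma group_ring_comm (R : comPzRingType) (gT : finGroupType)
  (a b : group_ring R gT) : abelian [set: gT] -> GRing.comm a b.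
Proof.
move=> cG; apply/ffunP => x; rewrite !gr_mulE.
rewrite (reindex_inj invg_inj) /= (reindex_inj (mulgI x^-1)%g) /=.
apply: eq_bigr => y _.
have cxy (u v : gT) : (u * v = v * u)%g by apply: (centsP cG); rewrite inE.
by rewrite mulrC !invMg !invgK (cxy _ y) mulgKV.
Qed.

(* R with the R[G]-module structure on which G acts trivially. *)
Section TrivialModule.
Variables (R : pzRingType) (gT : finGroupType).

Definition trivial_module : Type := R.
HB.instance Definition _ := GRing.Zmodule.on trivial_module.
Let scale (a : group_ring R gT) (x : trivial_module) : trivial_module :=
  (aug a : R) * x.
Fact trivial_scaleA a b x : scale a (scale b x) = scale (a * b) x.
Proof. by rewrite /scale rmorphM mulrA. Qed.
Fact trivial_scale1 : left_id 1 scale.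
Proof. by move=> x; rewrite /scale rmorph1 mul1r. Qed.
Fact trivial_scaleDr : right_distributive scale +%R.
Proof. by move=> a x y; rewrite /scale mulrDr. Qed.
Fact trivial_scaleDl x : {morph scale^~ x : a b / a + b}.
Proof. by move=> a b; rewrite /scale rmorphD mulrDl. Qed.
HB.instance Definition _ :=
  GRing.Zmodule_isLmodule.Build (group_ring R gT) trivial_module
    trivial_scaleA trivial_scale1 trivial_scaleDr trivial_scaleDl.
End TrivialModule.

Section Modules.
Variable R : pzRingType.

Definition lmod_iso (U V : lmodType R) : Prop :=
  exists f : {linear U -> V}, bijective f.

Section Submodule.
Variables (V : lmodType R) (N : submodClosed V).

Record submod := Submod { submod_val :> V; submod_valP : submod_val \in N }.
HB.instance Definition _ := [isSub for submod_val].
HB.instance Definition _ := [Choice of submod by <:].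
Fact submod_subproof : GRing.subsemimod_closed N.
Proof. exact: GRing.subsemimodClosedP. Qed.
HB.instance Definition _ :=
  GRing.SubChoice_isSubLmodule.Build R V [in N] submod submod_subproof.

(* submodClosed does not bundle closure under opposite, which Quotient.quot needs. *)
Definition submod_pred : {pred V} := [pred x | x \in N].
Fact submod_zmod_closed : zmod_closed submod_pred.
Proof. exact: (GRing.subsemimod_closedB submod_subproof). Qed.
HB.instance Definition _ := GRing.isZmodClosed.Build V submod_pred
  submod_zmod_closed.

Definition quotmod := (Quotient.quot submod_pred).
HB.instance Definition _ := GRing.Zmodule.on quotmod.

Local Open Scope quotient_scope.
Definition pi_quotmod (x : V) : quotmod := \pi_(Quotient.quot submod_pred) x.

Lemma pi_quotmodP x y : (pi_quotmod x = pi_quotmod y) <-> (x - y \in N).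
Proof.
rewrite -[x - y \in N]/(x - y \in submod_pred) Quotient.idealrBE.
by split => [/eqP|/eqP].
Qed.

Lemma pi_quotmod_surj (u : quotmod) : exists x, u = pi_quotmod x.
Proof. by exists (repr (u : (Quotient.quot submod_pred))); rewrite /pi_quotmod reprK. Qed.

Lemma pi_quotmodD x y : pi_quotmod (x + y) = pi_quotmod x + pi_quotmod y.
Proof. exact: (raddfD (\pi_(Quotient.quot submod_pred) : V -> (Quotient.quot submod_pred))). Qed.

Let scale (a : R) (u : quotmod) : quotmod :=
  pi_quotmod (a *: repr (u : (Quotient.quot submod_pred))).

Lemma scale_pi_quotmod a x : scale a (pi_quotmod x) = pi_quotmod (a *: x).
Proof.
apply/pi_quotmodP; rewrite -scalerBr; apply: rpredZ; apply/pi_quotmodP.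
by rewrite /pi_quotmod reprK.
Qed.

Fact quotmod_scaleA a b u : scale a (scale b u) = scale (a * b) u.
Proof. by have [x ->] := pi_quotmod_surj u; rewrite !scale_pi_quotmod scalerA. Qed.
Fact quotmod_scale1 : left_id 1 scale.
Proof.
by move=> u; have [x ->] := pi_quotmod_surj u; rewrite scale_pi_quotmod scale1r.
Qed.
Fact quotmod_scaleDr : right_distributive scale +%R.
Proof.
move=> a u v; have [x ->] := pi_quotmod_surj u; have [y ->] := pi_quotmod_surj v.
by rewrite -pi_quotmodD !scale_pi_quotmod scalerDr pi_quotmodD.
Qed.
Fact quotmod_scaleDl u : {morph scale^~ u : a b / a + b}.
Proof.
move=> a b; have [x ->] := pi_quotmod_surj u.
by rewrite !scale_pi_quotmod scalerDl pi_quotmodD.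
Qed.
HB.instance Definition _ := GRing.Zmodule_isLmodule.Build R quotmod
  quotmod_scaleA quotmod_scale1 quotmod_scaleDr quotmod_scaleDl.

Fact pi_quotmod_is_linear : linear pi_quotmod.
Proof. by move=> a x y; rewrite pi_quotmodD -scale_pi_quotmod. Qed.
HB.instance Definition _ :=
  GRing.isLinear.Build R V quotmod *:%R pi_quotmod pi_quotmod_is_linear.

(* The submodule a N.  For non-central a the set of all a *: x with x in N need
   not be a submodule, so a N is taken to be the submodule it generates; see
   scale_submodE for the central case. *)
Definition scale_submod (a : R) : {pred V} :=
  [pred x | `[< forall M : submodClosed V,
                  (forall y, y \in N -> a *: y \in M) -> x \in M >]].

Fact scale_submod_closed a : GRing.subsemimod_closed (scale_submod a).
Proof.
split; [split|].
- by apply/asboolP => M _; apply: rpred0.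
- move=> x y /asboolP xS /asboolP yS; apply/asboolP => M NM.
  by apply: rpredD; [exact: xS|exact: yS].
- by move=> b x /asboolP xS; apply/asboolP => M NM; apply: rpredZ; apply: xS.
Qed.
HB.instance Definition _ a :=
  GRing.isSubmodClosed.Build R V (scale_submod a) (scale_submod_closed a).

End Submodule.

Arguments scale_submod {V} N a.

Lemma scale_submodE (V : lmodType R) (N : submodClosed V) (a : R) (x : V) :
  (forall b, GRing.comm a b) ->
  (x \in scale_submod N a) <-> (exists2 y, y \in N & x = a *: y).
Proof.
move=> aC; split=> [/asboolP xS|[y yN ->]]; last first.
  by apply/asboolP => M; apply.
pose S : {pred V} := [pred z | `[< exists2 y, y \in N & z = a *: y >]].
have S_closed : GRing.subsemimod_closed S.
  split; [split|].
  - by apply/asboolP; exists 0; [exact: rpred0|rewrite scaler0].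
  - move=> z t /asboolP[y yN ->] /asboolP[u uN ->]; apply/asboolP.
    by exists (y + u); [exact: rpredD|rewrite scalerDr].
  - move=> b z /asboolP[y yN ->]; apply/asboolP.
    by exists (b *: y); [exact: rpredZ|rewrite !scalerA aC].
pose M : submodClosed V := HB.pack S (GRing.isSubmodClosed.Build R V S S_closed).
have /asboolP // : x \in M.
by apply: xS => y yN; apply/asboolP; exists y.
Qed.

(* Rank one: isomorphic to a quotient of the regular module. *)
Definition cyclic_module (A : lmodType R) : Prop :=
  exists N : submodClosed R^o, lmod_iso A (quotmod N).

Lemma cyclic_moduleP (A : lmodType R) :
  cyclic_module A <-> exists a : A, forall x, exists r, x = r *: a.
Proof.
split=> [[N [f [h fK hK]]]|[a aP]].
  exists (h (pi_quotmod N 1)) => x.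
  have [r fx] := pi_quotmod_surj (f x); exists r.
  rewrite -[LHS]fK fx; apply: (can_inj fK); rewrite linearZ !hK.
  by rewrite -linearZ /= -[_ *: _]/(r * 1 : R) mulr1.
pose S : {pred R^o} := [pred r | r *: a == 0].
have S_closed : GRing.subsemimod_closed S.
  split; [split|]; rewrite ?inE ?scale0r //.
    by move=> r s; rewrite !inE scalerDl => /eqP -> /eqP ->; rewrite addr0.
  by move=> b r; rewrite !inE -scalerA => /eqP ->; rewrite scaler0.
pose N : submodClosed R^o :=
  HB.pack S (GRing.isSubmodClosed.Build R R^o S S_closed).
have piN (r s : R) : pi_quotmod N r = pi_quotmod N s <-> r *: a = s *: a.
  rewrite pi_quotmodP -[_ \in N]/((r - s) *: a == 0) scalerBl subr_eq0.
  by split => /eqP.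
pose c x : R := projT1 (cid (aP x)).
have cP x : c x *: a = x by rewrite /c; case: cid.
pose f x := pi_quotmod N (c x).
have f_lin : linear f.
  move=> b x y; rewrite /f -linearP; apply/piN.
  by rewrite scalerDl -scalerA !cP.
pose fL : {linear A -> quotmod N} :=
  HB.pack f (GRing.isLinear.Build R A (quotmod N) *:%R f f_lin).
exists N, fL.
pose d (u : quotmod N) : R := projT1 (cid (pi_quotmod_surj u)).
have dP (u : quotmod N) : u = pi_quotmod N (d u) by rewrite /d; case: cid.
exists (fun u => d u *: a) => [x|u] /=.
  by rewrite -[RHS]cP; apply/piN; rewrite -dP.
by rewrite [RHS]dP; apply/piN; rewrite cP.
Qed.

End Modules.

Section GroupRingModules.
Variables (R : pzRingType) (gT : finGroupType).
Local Notation RG := (group_ring R gT).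

Definition aug_ideal : {pred RG^o} := [pred a | aug a == 0].
Fact aug_ideal_closed : GRing.subsemimod_closed aug_ideal.
Proof.
split; [split|]; rewrite ?inE ?raddf0 //.
  by move=> a b; rewrite !inE raddfD /= => /eqP -> /eqP ->; rewrite addr0.
move=> a b; rewrite !inE [a *: b]/(a * b : RG) rmorphM /= => /eqP ->.
by rewrite mulr0.
Qed.
HB.instance Definition _ :=
  GRing.isSubmodClosed.Build RG RG^o aug_ideal aug_ideal_closed.

Definition fixed_points (V : lmodType RG) : {pred V} :=
  [pred x | [forall h : gT, gr_elt R h *: x == x]].
Fact fixed_points_closed V : GRing.subsemimod_closed (@fixed_points V).
Proof.
split; [split|].
- by apply/forallP => h; rewrite scaler0.
- move=> x y /forallP fx /forallP fy; apply/forallP => h.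
  by rewrite scalerDr (eqP (fx h)) (eqP (fy h)).
- move=> a x /forallP fx; apply/forallP => h; apply/eqP.
  have sx b : b *: x = \sum_k gr_scalar gT (b k) *: x.
    rewrite {1}[b]gr_decomp scaler_suml; apply: eq_bigr => k _.
    by rewrite -scalerA (eqP (fx k)).
  rewrite sx scaler_sumr; apply: eq_bigr => k _.
  by rewrite scalerA gr_elt_scalar -scalerA (eqP (fx h)).
Qed.
HB.instance Definition _ V :=
  GRing.isSubmodClosed.Build RG V (@fixed_points V) (@fixed_points_closed V).

End GroupRingModules.

Arguments aug_ideal : clear implicits.
Arguments fixed_points {R gT} V.

Definition torsion (p : nat) (A : zmodType) : set A :=
  [set a | exists2 l : nat, (0 < l)%N & a *+ (p ^ l) = 0].
Arguments torsion : clear implicits.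

(* Main.v *)
Require Import Defs.
From HB Require Import structures.
From mathcomp Require Import all_boot all_order all_algebra all_fingroup.
From mathcomp Require Import boolp classical_sets functions cardinality.

(** The theorem is a classification of the ideals of the group ring L: a cyclic
module with generator a is L / K, where K is the annihilator of a.

Rationally, L is the product of Q_p, on which g acts trivially, and of the field
Q_p(zeta).  So K is zero, or of finite index, or contained in one of the two
kernels: the fixed points L^G, generated by the norm (the sum of the group
elements), or the augmentation ideal, generated by g - 1.  In integral terms: if
K is contained in neither kernel, then multiplying elements of K by the norm and
by g - 1 produces multiples of these two elements by powers of p, and p is the
norm up to a multiple of g - 1 ([norm_decomp]), so K contains a power of p and A
is finite ([infinite_annihilator]).

Each of the two kernels is a module over a discrete valuation ring, free of rank
one: L^G over Z_p with uniformizer p, and the augmentation ideal over Z_p[zeta],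
on which g - 1 acts as the uniformizer.  Both are treated together, as an ideal
e L with an element t such that, for y in L, e y lies in t e L exactly when p
divides the augmentation of y.  As L is local, the elements of augmentation prime
to p being its units ([aug_ndvd_unit]), the nonzero ideals inside e L are the
t^n e L ([chain_ideal]); and since L / e L has no p-torsion, the torsion of
L / t^n e L is e L / t^n e L, of order p^n by base p expansions with respect to t
([card_chain_torsion]).

Hence K = 0 gives A = L without torsion, and the two chains give the two families
with torsion of order p^n.  For n = 0 there is no torsion and A is L / L^G, which
g - 1 identifies with the augmentation ideal, or L modulo the augmentation ideal,
which is Z_p. *)

Set Implicit Arguments.
Unset Strict Implicit.
Unset Printing Implicit Defensive.

Import GRing.Theory intdiv.
Local Open Scope ring_scope.

(** * Approximation and completeness in the p-adic integers *)

Section PadicIntegers.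
Variable p : nat.
Hypothesis p_gt0 : (0 < p)%N.
Implicit Types (x y : padic p) (k m n : nat).

Lemma padic_val0 n : (0 : padic p) n = 0. Proof. exact: mod0z. Qed.

Lemma padic_valMn x k n : (x *+ k) n = ((x n * k%:Z) %% (p ^ n)%N%:Z)%Z.
Proof.
elim: k => [|k IHk]; first by rewrite mulr0n mulr0.
rewrite mulrS -[LHS]/((x n + (x *+ k) n) %% (p ^ n)%N%:Z)%Z IHk modzDmr.
by rewrite -add1n PoszD mulrDr mulr1.
Qed.

Lemma padic_modE x m n : (x (m + n)%N %% (p ^ n)%N%:Z)%Z = x n.
Proof.
elim: m n => [|m IHm] n; first by rewrite padic_mod.
by rewrite addSnnS -[LHS]modz_padic IHm padicE.
Qed.

(** The valuation filtration is the filtration by components: when the n-th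
component vanishes, all components are divisible by p^n from the n-th on, and
the quotients, shifted by n places, form the coherent sequence of y. *)
Lemma padic_dvdP x n : x n = 0 <-> exists y, x = y *+ p ^ n.
Proof.
have q_neq0 k : (p ^ k)%N%:Z != 0 by rewrite -lt0n expn_gt0 p_gt0.
split=> [xn0|[y ->]]; last by rewrite padic_valMn modzMl.
have dvdx m : (x (m + n)%N = (x (m + n)%N %/ (p ^ n)%N%:Z)%Z * (p ^ n)%N%:Z)%Z.
  by rewrite {1}(divz_eq (x (m + n)%N) (p ^ n)%N%:Z) padic_modE xn0 addr0.
have coh m : ((x (m.+1 + n)%N %/ (p ^ n)%N%:Z)%Z
              = (x (m + n)%N %/ (p ^ n)%N%:Z)%Z %[mod (p ^ m)%N%:Z])%Z.
  apply/eqP; rewrite eqz_mod_dvd -(dvdz_mul2r (q_neq0 n)) mulrBl -!dvdx.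
  by rewrite -PoszM -expnD -eqz_mod_dvd addSn padicE padic_mod.
exists (Padic (padic_subproof coh)); apply: padicP => m.
by rewrite padic_valMn /= modzMml -dvdx addnC padic_modE.
Qed.

Lemma padic_eq0 x : (forall n, exists y, x = y *+ p ^ n) -> x = 0.
Proof.
by move=> x_div; apply: padicP => n; rewrite (padic_dvdP x n).2 // padic_val0.
Qed.

(** Multiplication by p is not injective on Z/p^n, but its kernel dies in
Z/p^(n-1); so each component is read off the next one. *)
Lemma padic_mulpnI n x : x *+ p ^ n = 0 -> x = 0.
Proof.
suff mulpI y : y *+ p = 0 -> y = 0.
  elim: n => [|n IHn]; first by rewrite mulr1n.
  by rewrite expnSr mulrnA => /mulpI/IHn.
move=> yp0; apply: padicP => m; rewrite padic_val0.
have p_neq0 : p%:Z != 0 by rewrite -lt0n.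
have: (y m.+1 * p%:Z %% (p ^ m.+1)%N%:Z)%Z = 0 by rewrite -padic_valMn yp0 padic_val0.
rewrite expnSr PoszM -mulz_modl ?ltz_nat // padicE => /eqP.
by rewrite mulf_eq0 (negPf p_neq0) orbF => /eqP.
Qed.

Lemma padic_approx x n :
  exists2 k, (k < p ^ n)%N & exists y, x = k%:R + y *+ p ^ n.
Proof.
have q_gt0 : 0 < (p ^ n)%N%:Z by rewrite ltz_nat expn_gt0 p_gt0.
have xnE : x n = `|x n|%N :> int.
  by rewrite gez0_abs // -padic_mod modz_ge0 // -lt0n expn_gt0 p_gt0.
exists `|x n|%N; first by rewrite -ltz_nat -xnE -padic_mod ltz_pmod.
have [|y yE] := (padic_dvdP (x - `|x n|%N%:R) n).1; last first.
  by exists y; rewrite -yE addrC subrK.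
rewrite -[LHS]/((x n + (- (`|x n|%N%:R : padic p)) n) %% (p ^ n)%N%:Z)%Z.
rewrite -[X in _ + X]/((- (`|x n|%N%:R : padic p) n) %% (p ^ n)%N%:Z)%Z.
rewrite padic_valMn -[(1 : padic p) n]/(1 %% (p ^ n)%N%:Z)%Z.
by rewrite modzMml mul1r modzNm modzDmr -xnE subrr mod0z.
Qed.

Lemma padic_digit x : exists2 k, (k < p)%N & exists y, x = k%:R + y *+ p.
Proof. by have := padic_approx x 1; rewrite expn1. Qed.

Lemma padic_natr_dvd k : (exists y : padic p, k%:R = y *+ p) <-> (p %| k)%N.
Proof.
have := padic_dvdP k%:R 1%N; rewrite expn1 => <-.
rewrite padic_valMn -[(1 : padic p) 1%N]/(1 %% (p ^ 1)%N%:Z)%Z modzMml mul1r.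
by rewrite expn1; split=> [/dvdz_mod0P|kp]; [|apply/dvdz_mod0P].
Qed.

(** Residue digits are unique; together with [padic_digit] this identifies the
residue ring of the p-adic integers with {0, ..., p-1}. *)
Lemma padic_digit_inj k l :
  (k < p)%N -> (l < p)%N -> (exists y : padic p, k%:R - l%:R = y *+ p) -> k = l.
Proof.
wlog le_lk : k l / (l <= k)%N => [wlog_le|] k_lt l_lt [y yE].
  have [/wlog_le|/ltnW/wlog_le kl] := leqP l k; first by apply=> //; exists y.
  by apply/esym/kl => //; exists (- y); rewrite mulNrn -yE opprB.
have /padic_natr_dvd : exists y : padic p, (k - l)%:R = y *+ p.
  by exists y; rewrite natrB.
have [kl0|kl_gt0] := posnP (k - l); last first.
  by rewrite gtnNdvd // (leq_ltn_trans (leq_subr l k)).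
by move=> _; apply/eqP; rewrite eqn_leq le_lk andbT -subn_eq0 kl0.
Qed.

(** Completeness: s n is correct modulo p^n, so the diagonal sequence of the
n-th components of s n is coherent and is the limit. *)
Lemma padic_limit (s : nat -> padic p) :
    (forall n, exists d, s n.+1 = s n + d *+ p ^ n) ->
  exists l, forall n, exists d, l = s n + d *+ p ^ n.
Proof.
move=> s_cauchy.
have valD x n d : (x + d *+ p ^ n) n = x n.
  rewrite -[LHS]/((x n + (d *+ p ^ n) n) %% (p ^ n)%N%:Z)%Z.
  by rewrite padic_valMn modzMl addr0 padic_mod.
have coh n : (s n.+1 n.+1 = s n n %[mod (p ^ n)%N%:Z])%Z.
  by have [d sn] := s_cauchy n; rewrite padicE padic_mod sn valD.
exists (Padic (padic_subproof coh)) => n.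
set l := Padic _; have [|d dE] := (padic_dvdP (l - s n) n).1.
  rewrite -[LHS]/((l n + (- s n n %% (p ^ n)%N%:Z)%Z) %% (p ^ n)%N%:Z)%Z.
  by rewrite modzDmr modzDml subrr mod0z.
by exists d; rewrite -dE addrC subrK.
Qed.

End PadicIntegers.


(** * Identities valid in any ring *)

Lemma geometric_sum (R : pzRingType) (x : R) n :
  (\sum_(i < n) x ^+ i) * (1 - x) = 1 - x ^+ n.
Proof.
elim: n => [|n IHn]; first by rewrite big_ord0 mul0r subrr.
by rewrite big_ord_recr /= mulrDl IHn mulrBr mulr1 -exprSr addrA subrK.
Qed.

(** The inner binomial coefficients of order p are divisible by p. *)
Lemma expr1D_modp (R : pzRingType) (p : nat) (x : R) :
  prime p -> exists w, (1 + x) ^+ p = 1 + (x ^+ p + w *+ p).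
Proof.
case: p => // q q_pr; rewrite exprDn_comm; last exact/commr_sym/commr1.
exists (\sum_(i < q) x ^+ i.+1 *+ ('C(q.+1, i.+1) %/ q.+1)).
rewrite big_ord_recl big_ord_recr /= /bump !add1n subn0 expr0 mulr1 bin0.
rewrite expr1n subnn !expr0 !mul1r binn !mulr1n; congr (_ + _).
rewrite addrC; congr (_ + _); rewrite -sumrMnl; apply: eq_bigr => i _.
rewrite expr1n mul1r -mulrnA divnK //.
by apply: prime_dvd_bin => //=; rewrite ltnS.
Qed.

(** * Scalars, norm and p-adic completeness of the group ring *)

Section GroupRingScalars.
Variables (R : pzRingType) (gT : finGroupType).
Implicit Types (r s : R) (n : nat) (h : gT).

Lemma gr_scalarD r s :
  gr_scalar gT (r + s) = gr_scalar gT r + gr_scalar gT s.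
Proof. by apply/ffunP => x; rewrite !ffunE; case: eqP; rewrite ?addr0. Qed.

Lemma gr_scalarMn r n : gr_scalar gT (r *+ n) = gr_scalar gT r *+ n.
Proof. by apply/ffunP => x; rewrite ffunMnE !ffunE; case: eqP; rewrite ?mul0rn. Qed.

Lemma gr_scalar_nat n : gr_scalar gT n%:R = n%:R :> group_ring R gT.
Proof.
rewrite gr_scalarMn; congr (_ *+ _).
by apply/ffunP => x; rewrite !ffunE; case: eqP.
Qed.

Lemma gr_eltX h n : gr_elt R h ^+ n = gr_elt R (h ^+ n)%g.
Proof.
elim: n => [|n IHn]; first by apply/ffunP => x; rewrite !ffunE.
rewrite exprS expgS IHn; apply/ffunP => x.
by rewrite gr_eltM !ffunE; congr (nat_of_bool _)%:R; rewrite -(inj_eq (mulgI h)) mulKVg.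
Qed.

Lemma aug_gr_elt h : aug (gr_elt R h) = 1.
Proof.
by rewrite /aug (bigD1 h) //= big1 => [|x xh]; rewrite ffunE ?eqxx ?addr0 ?(negPf xh).
Qed.

Lemma aug_gr_scalar r : aug (gr_scalar gT r) = r.
Proof.
rewrite /aug (bigD1 1%g) //= big1 => [|x x1]; first by rewrite ffunE eqxx addr0.
by rewrite ffunE (negPf x1).
Qed.

(** The sum of all the elements of the group, an element of the group ring. *)
Definition gr_norm : group_ring R gT := [ffun=> 1].

Lemma aug_gr_norm : aug gr_norm = #|gT|%:R.
Proof. by rewrite /aug; under eq_bigr do rewrite ffunE; rewrite sumr_const. Qed.

End GroupRingScalars.
Arguments gr_norm {R gT}.

Section PadicGroupRing.
Variables (p : nat) (gT : finGroupType).
Hypothesis p_gt0 : (0 < p)%N.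
Local Notation L := (group_ring (padic p) gT).
Implicit Types (x y w : L) (m n : nat).

Lemma gr_eq0 x : (forall n, exists w, x = w *+ p ^ n) -> x = 0.
Proof.
move=> x_div; apply/ffunP => h; rewrite ffunE.
apply: (padic_eq0 p_gt0) => n; have [w ->] := x_div n.
by exists (w h); rewrite ffunMnE.
Qed.

Lemma gr_mulpnI n x : x *+ p ^ n = 0 -> x = 0.
Proof.
move=> xpn0; apply/ffunP => h; rewrite ffunE.
by apply: (@padic_mulpnI p p_gt0 n); rewrite -ffunMnE xpn0 ffunE.
Qed.

Lemma gr_limit (s : nat -> L) :
    (forall n, exists d, s n.+1 = s n + d *+ p ^ n) ->
  exists l, forall n, exists d, l = s n + d *+ p ^ n.
Proof.
move=> s_cauchy.
have lim h : exists l, forall n, exists d, l = s n h + d *+ p ^ n.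
  apply: padic_limit => // n; have [d ->] := s_cauchy n.
  by exists (d h); rewrite ffunE ffunMnE.
have [l lP] := choice lim.
exists [ffun h => l h] => n.
have [d dP] := choice (lP^~ n).
by exists [ffun h => d h]; apply/ffunP => h; rewrite !ffunE ffunMnE ffunE.
Qed.

(** The inverse is the sum of the geometric series of w p, which converges
because the group ring is complete for the p-adic topology. *)
Lemma gr_inv_1subp w : exists y, y * (1 - w *+ p) = 1.
Proof.
set q := w *+ p.
have qX n : q ^+ n = w ^+ n *+ p ^ n by rewrite exprMn_n.
have [|y yP] := @gr_limit (fun n => \sum_(i < n) q ^+ i).
  by move=> n; exists (w ^+ n); rewrite big_ord_recr /= qX.
exists y; apply/eqP; rewrite -subr_eq0; apply/eqP/gr_eq0 => n.
have [d ->] := yP n; exists (d * (1 - q) - w ^+ n).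
rewrite mulrDl geometric_sum mulrnAl mulrnBl -qX.
by rewrite addrAC [1 - _]addrC addrK addrC.
Qed.

(** A finite geometric sum turns 1 - x into 1 - x^n, which is 1 modulo p. *)
Lemma gr_unit_of_nilp_modp x n w :
  x ^+ n = w *+ p -> exists y, y * (1 - x) = 1.
Proof.
move=> xnE; have [y yP] := gr_inv_1subp w.
exists (y * \sum_(i < n) x ^+ i).
by rewrite -mulrA geometric_sum xnE.
Qed.

End PadicGroupRing.


(** * The group ring of a cyclic group of order p is local *)

Section CyclicGroupRing.
Variables (p : nat) (gT : finGroupType) (g : gT).
Hypothesis p_pr : prime p.
Hypothesis g_gen : <[g]>%g = [set: gT]%SET.
Hypothesis card_gT : #|gT| = p.
Local Notation L := (group_ring (padic p) gT).
Local Notation D := (gr_elt (padic p) g - 1).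
Local Notation sc := (gr_scalar gT).
Implicit Types (x y z w : L) (m n : nat).

Let p_gt0 : (0 < p)%N. Proof. exact: prime_gt0. Qed.

Lemma cyclic_gr_mulC x y : x * y = y * x.
Proof. by apply: group_ring_comm; rewrite -g_gen cycle_abelian. Qed.

Lemma cyclic_gr_mulCA x y z : x * (y * z) = y * (x * z).
Proof. by rewrite !mulrA [x * y]cyclic_gr_mulC. Qed.

Lemma aug_gsub1 : aug D = 0.
Proof. by rewrite rmorphB rmorph1 /= aug_gr_elt subrr. Qed.

(** Every group element is a power of g, and X - 1 divides X^i - 1; hence the
augmentation ideal is generated by g - 1. *)
Lemma aug_decomp x : exists z, x = sc (aug x) + D * z.
Proof.
have elt h : exists z, gr_elt (padic p) h = 1 + D * z.
  have /cycleP[i ->] : h \in <[g]>%g by rewrite g_gen inE.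
  by exists (\sum_(j < i) gr_elt (padic p) g ^+ j); rewrite -subrX1 gr_eltX addrC subrK.
have [z zP] := choice elt.
exists (\sum_h sc (x h) * z h).
rewrite {1}[x]gr_decomp /aug.
have -> : sc (\sum_h x h) = \sum_h sc (x h).
  apply: (big_morph (fun r : padic p => sc r)) => [r s|]; first exact: gr_scalarD.
  by apply/ffunP => h; rewrite !ffunE; case: eqP.
rewrite mulr_sumr -big_split; apply: eq_bigr => h _.
by rewrite zP mulrDr mulr1 cyclic_gr_mulCA.
Qed.

Lemma aug_eq0_gsub1 x : aug x = 0 -> exists z, x = D * z.
Proof.
move=> augx; have [z xE] := aug_decomp x; exists z; rewrite {1}xE augx.
by rewrite (gr_scalar_nat (padic p) gT 0) add0r.
Qed.

Lemma gr_normM x : gr_norm * x = sc (aug x) * gr_norm.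
Proof.
apply/ffunP => h; rewrite gr_scalarM gr_mulE ffunE mulr1 /aug.
under eq_bigr do rewrite ffunE mul1r.
rewrite (reindex_inj invg_inj) (reindex_inj (mulIg h^-1)%g) /=.
by apply: eq_bigr => y _; rewrite invgK mulgKV.
Qed.

Lemma gsub1_norm : D * gr_norm = 0.
Proof.
by rewrite cyclic_gr_mulC gr_normM aug_gsub1 (gr_scalar_nat (padic p) gT 0) mul0r.
Qed.

(** An element killed by g - 1 is invariant under translation by g, so its
coefficients are constant on the whole group. *)
Lemma gsub1_ker x : D * x = 0 -> x = sc (x 1%g) * gr_norm.
Proof.
move=> Dx0; have gx : gr_elt (padic p) g * x = x.
  by apply/eqP; rewrite -subr_eq0 -[X in _ - X]mul1r -mulrBl Dx0.
apply/ffunP => h; rewrite gr_scalarM ffunE mulr1.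
have /cycleP[i ->] : h \in <[g]>%g by rewrite g_gen inE.
elim: i => [//|i IHi]; rewrite -{1}gx gr_eltM expgS mulKg; exact: IHi.
Qed.

(** The relation between the three elements that govern the ring: p is the norm
up to a multiple of g - 1, because the norm has augmentation p. *)
Lemma norm_decomp : exists z, gr_norm = p%:R + D * z.
Proof.
have [z zE] := aug_decomp gr_norm; exists z.
by move: zE; rewrite aug_gr_norm [X in X%:R]card_gT gr_scalar_nat.
Qed.

(** Modulo p, the Frobenius map sends g = 1 + (g - 1) to 1 + (g - 1)^p, while
g^p = 1. *)
Lemma gsub1_expp : exists w, D ^+ p = w *+ p.
Proof.
have gp : (1 + D) ^+ p = 1.
  have gX : (g ^+ p)%g = 1%g by rewrite -card_gT -cardsT -g_gen expg_order.
  by rewrite addrC subrK gr_eltX gX; apply/ffunP => h; rewrite !ffunE.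
move: gp; have [w ->] := expr1D_modp D p_pr => wE; exists (- w).
move: wE => /(canRL (addKr _)); rewrite addNr.
by move=> /(canRL (addrK _)); rewrite add0r mulNrn.
Qed.

Lemma exp_addp_modp x w n : exists w', (x + w *+ p) ^+ n = x ^+ n + w' *+ p.
Proof.
elim: n => [|n [w' IHn]]; first by exists 0; rewrite mul0rn addr0.
exists (x * w' + w * (x + w *+ p) ^+ n).
by rewrite exprS mulrDl {1}IHn mulrDr -exprS mulrnAl mulrnAr -addrA mulrnDl.
Qed.

(** Such an x lies in the ideal generated by p and g - 1, whose generators both
have their p-th power divisible by p. *)
Lemma aug_dvd_nilp_modp x :
  (exists c, aug x = c *+ p) -> exists w, x ^+ p = w *+ p.
Proof.
move=> [c augx]; have [z zE] := aug_decomp x.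
have [w wE] := gsub1_expp.
have [w' w'E] := exp_addp_modp (D * z) (sc c) p.
exists (w * z ^+ p + w').
rewrite {1}zE augx gr_scalarMn addrC w'E exprMn_comm; last exact: cyclic_gr_mulC.
by rewrite wE mulrnDl mulrnAl.
Qed.

(** This is the locality of the group ring.  The augmentation is a unit modulo p,
so an integer multiple of x has the form 1 - y with the augmentation of y
divisible by p; such a y is nilpotent modulo p. *)
Lemma aug_ndvd_unit x :
  ~ (exists c, aug x = c *+ p) -> exists u, u * x = 1.
Proof.
move=> augx; have [k k_ltp [c cE]] := padic_digit p_gt0 (aug x).
have k_gt0 : (0 < k)%N.
  by case: k cE {k_ltp} => // cE; case: augx; exists c; rewrite cE add0r.
have cop : coprime k p.
  by rewrite coprime_sym prime_coprime // gtnNdvd.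
case: (egcdnP p k_gt0) => a b; rewrite (eqP cop) => abE _.
have [|w wE] := @aug_dvd_nilp_modp (1 - x *+ a).
  (* Bezout: a k = b p + 1, and k is the first digit of aug x. *)
  exists (- b%:R - c *+ a).
  rewrite rmorphB rmorph1 rmorphMn /= cE mulrnDl -mulrnA mulnC abE natrD.
  rewrite natrM mulr_natr mulrnBl mulNrn.
  by rewrite [X in 1 - X]addrAC opprD addrCA subrr addr0 opprD [c *+ p *+ a]mulrnAC.
have [u uE] := gr_unit_of_nilp_modp p_gt0 wE.
by exists (u *+ a); rewrite -uE opprB addrC subrK mulrnAl mulrnAr.
Qed.

End CyclicGroupRing.


(** * Principal ideals whose submodules form a chain *)

(** The ideal generated by e is a module of rank one over a discrete valuation
ring, in which t acts as a uniformizer; t e generates its submodule of index p: [chain_step] says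
that e y lies in that submodule exactly when the augmentation of y is divisible
by p, and [chain_inj] that t acts injectively.  The theory applies to the norm
with t = p, and to e = t = g - 1. *)
Section PrincipalChain.
Variables (p : nat) (gT : finGroupType) (g : gT).
Hypothesis p_pr : prime p.
Hypothesis g_gen : <[g]>%g = [set: gT]%SET.
Hypothesis card_gT : #|gT| = p.
Local Notation L := (group_ring (padic p) gT).
Implicit Types (x y z w : L) (m n : nat).

Let p_gt0 : (0 < p)%N. Proof. exact: prime_gt0. Qed.
Let mulC := @cyclic_gr_mulC p gT g g_gen.
Let mulCA := @cyclic_gr_mulCA p gT g g_gen.

Variables e t : L.
Hypothesis aug_t : exists c, aug t = c *+ p.
Hypothesis chain_step : forall y,
  (exists z, e * y = t * (e * z)) <-> (exists c, aug y = c *+ p).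
Hypothesis chain_inj : forall y, t * (e * y) = 0 -> e * y = 0.

(** As long as the cofactor has augmentation divisible by p, one more factor t
comes out.  Since a power of t is divisible by p, an element that allows this
forever is divisible by all powers of p, hence is zero. *)
Lemma chain_valuation x : x <> 0 -> (exists z, x = e * z) ->
  exists m y, x = t ^+ m * (e * y) /\ ~ (exists c, aug y = c *+ p).
Proof.
move=> x_neq0 [z xE]; apply: contrapT => no_val; apply: x_neq0.
have deep m : exists y, x = t ^+ m * (e * y).
  elim: m => [|m [y yE]]; first by exists z; rewrite mul1r.
  have [/chain_step[z' z'E]|y_unit] := pselect (exists c, aug y = c *+ p).
    by exists z'; rewrite yE z'E mulrA -exprSr.
  by case: no_val; exists m, y.
have [w wE] := aug_dvd_nilp_modp p_pr g_gen card_gT aug_t.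
apply: (gr_eq0 p_gt0) => k; have [y ->] := deep (p * k)%N.
by exists (w ^+ k * (e * y)); rewrite exprM wE exprMn_n mulrnAl.
Qed.

(** An element of valuation m is t^m e times a unit, so an ideal contains t^m e as
soon as it contains an element of valuation m; the smallest such m determines
the ideal. *)
Lemma chain_ideal (K : L -> Prop) :
    (forall r x, K x -> K (r * x)) -> (forall x, K x -> exists z, x = e * z) ->
    K 0 -> (exists2 x, K x & x <> 0) ->
  exists n, forall x, K x <-> exists z, x = t ^+ n * (e * z).
Proof.
move=> KM K_sub K0 [x0 Kx0 x0_neq0].
have valK x : K x -> x <> 0 ->
    exists m, K (t ^+ m * e) /\ exists z, x = t ^+ m * (e * z).
  move=> Kx x_neq0; have [m [y [xE y_unit]]] := chain_valuation x_neq0 (K_sub _ Kx).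
  exists m; split; last by exists y.
  have [u uy] := aug_ndvd_unit p_pr g_gen card_gT y_unit.
  have -> : t ^+ m * e = u * x by rewrite xE mulCA [u * _]mulCA uy mulr1.
  exact: KM.
have exK : exists n, `[< K (t ^+ n * e) >].
  by have [m [Km _]] := valK x0 Kx0 x0_neq0; exists m; apply/asboolP.
case: (ex_minnP exK) => n /asboolP Kn n_min; exists n => x; split=> [Kx|[z ->]].
  have [->|/eqP x_neq0] := eqVneq x 0; first by exists 0; rewrite !mulr0.
  have [m [/asboolP/n_min le_nm [z ->]]] := valK x Kx x_neq0.
  exists (t ^+ (m - n) * z).
  by rewrite -{1}(subnKC le_nm) exprD -mulrA; congr (_ * _); rewrite mulCA.
by rewrite mulrA mulC; apply: KM.
Qed.

(** Since p has augmentation p, [chain_step] gives e p as a multiple of t e. *)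
Lemma chain_killed n : exists u, e *+ p ^ n = t ^+ n * (e * u).
Proof.
have [|w wE] := (chain_step p%:R).2; first by exists 1; rewrite rmorph_nat.
elim: n => [|n [u uE]]; first by exists 1; rewrite mulr1 mul1r.
exists (w * u); rewrite expnSr mulrnA uE -mulrnAr -mulrnAl -[e in LHS]mulr1 -mulrnAr wE.
by rewrite exprSr !mulrA.
Qed.

(** By [chain_ideal], the intersection of K with the ideal of e contains some
t^n e, of which p^n e is a multiple. *)
Lemma chain_exponent (K : L -> Prop) :
    (forall r x, K x -> K (r * x)) -> K 0 ->
    (exists2 x, K (e * x) & e * x <> 0) ->
  exists n, K (e *+ p ^ n).
Proof.
move=> KM K0 [x Kex ex_neq0].
have [|y [_ ?]|||n Kn] := @chain_ideal (fun y => K y /\ exists z, y = e * z).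
- by move=> r y [Ky [z yE]]; split; [exact: KM|exists (r * z); rewrite yE mulCA].
- by [].
- by split=> //; exists 0; rewrite mulr0.
- by exists (e * x); first by split=> //; exists x.
by exists n; have [u uE] := chain_killed n; apply: ((Kn _).2 (ex_intro _ u uE)).1.
Qed.

(** The expansion sum of a_i t^i over i < n, where the a_i are the first n digits of
k in base p.  For k < p^n, the multiples of e by these sums represent each class
of e L modulo t^n e L exactly once, so there are p^n classes. *)
Fixpoint digit_sum n k : L :=
  if n is m.+1 then (k %% p)%N%:R + t * digit_sum m (k %/ p)%N else 0.

Lemma digit_sum_onto n x : exists2 k, (k < p ^ n)%N &
  exists z, e * (x - digit_sum n k) = t ^+ n * (e * z).
Proof.
elim: n x => [|n IHn] x; first by exists 0%N => //; exists x; rewrite subr0 mul1r.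
have [k0 k0_lt [c cE]] := padic_digit p_gt0 (aug x).
have [|z zE] := (chain_step (x - k0%:R)).2.
  by exists c; rewrite rmorphB rmorph_nat /= cE addrC addKr.
have [k k_lt [z' z'E]] := IHn z.
exists (k * p + k0)%N.
  rewrite expnSr (leq_trans _ (_ : k.+1 * p <= _)%N) ?leq_mul //.
  by rewrite mulSn addnC ltn_add2r.
exists z'; rewrite /= modnMDl modn_small // divnMDl // divn_small // addn0.
rewrite opprD addrA mulrBr zE [e * (t * _)]mulCA -mulrBr -mulrBr.
by rewrite z'E exprS -[in RHS]mulrA.
Qed.

Lemma digit_sum_inj n k k' z : (k < p ^ n)%N -> (k' < p ^ n)%N ->
  e * (digit_sum n k - digit_sum n k') = t ^+ n * (e * z) -> k = k'.
Proof.
elim: n k k' => [|n IHn] k k'; first by case: k k' => [|k] [|k'].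
rewrite expnSr => k_lt k'_lt /=; set r := digit_sum n _; set r' := digit_sum n _.
rewrite opprD addrACA -mulrBr mulrDr [e * (t * _)]mulCA exprS -[in RHS]mulrA => E.
have low : e * ((k %% p)%N%:R - (k' %% p)%N%:R) = t * (e * (t ^+ n * z - (r - r'))).
  by rewrite [in RHS]mulrBr [in RHS]mulrBr [e * (t ^+ n * _)]mulCA -E addrK.
have kk' : (k %% p = k' %% p)%N.
  apply: (padic_digit_inj p_gt0); rewrite ?ltn_pmod //.
  have [c cE] := (chain_step _).1 (ex_intro _ _ low).
  by exists c; rewrite -cE rmorphB !rmorph_nat.
suff kk'_div : (k %/ p = k' %/ p)%N.
  by rewrite (divn_eq k p) (divn_eq k' p) kk' kk'_div.
apply: IHn; rewrite ?ltn_divLR //; apply/eqP.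
rewrite -subr_eq0 [t ^+ n * _]mulCA -mulrBr; apply/eqP/chain_inj.
by rewrite mulrBr mulrBr [e * (t ^+ n * _)]mulCA -E kk' subrr mulr0 add0r subrr.
Qed.

Variable A : lmodType L.
Variables (a : A) (n : nat).
Hypothesis a_gen : forall b : A, exists x, b = x *: a.
Hypothesis quot_torsfree : forall x m,
  (exists z, x *+ p ^ m = e * z) -> exists z, x = e * z.
Hypothesis ann_a : forall x, x *: a = 0 <-> exists z, x = t ^+ n * (e * z).

(** The torsion of L / t^n e L is e L / t^n e L: the quotient by e L has no
p-torsion, and p^n kills what remains. *)
Lemma chain_torsion :
  torsion p A = [set x *: a | x in [set e * z | z in setT]]%classic.
Proof.
apply/seteqP; split=> [b [l l_gt0]|_ [_ [z _ <-] <-]].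
  have [x ->] := a_gen b; rewrite scalerMnl => /ann_a[z zE].
  have [|y xE] := quot_torsfree (x := x) (m := l).
    by exists (t ^+ n * z); rewrite zE mulCA.
  by exists x => //; exists y.
(* The definition of torsion asks for a positive exponent; n may be zero. *)
exists n.+1 => //; rewrite scalerMnl; apply/ann_a.
have [u uE] := chain_killed n.
by exists (u * z *+ p); rewrite expnSr mulrnA -[e * z *+ _]mulrnAl uE !mulrnAr !mulrA.
Qed.

Lemma card_chain_torsion : (torsion p A #= `I_(p ^ n))%card.
Proof.
have -> : torsion p A = [set (e * digit_sum n k) *: a | k in `I_(p ^ n)]%classic.
  rewrite chain_torsion; apply/seteqP; split=> [_ [_ [z _ <-] <-]|_ [k _ <-]].
    have [k k_lt kz] := digit_sum_onto n z; exists k => //.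
    by apply/esym/eqP; rewrite -subr_eq0 -scalerBl -mulrBr; apply/eqP/ann_a.
  by exists (e * digit_sum n k) => //; exists (digit_sum n k).
apply: inj_card_eq => k k'; rewrite !inE => k_lt k'_lt /eqP.
rewrite -subr_eq0 -scalerBl -mulrBr => /eqP/ann_a[z].
exact: digit_sum_inj.
Qed.

End PrincipalChain.


(** * The fixed points and the augmentation ideal as chains *)

Section TwoChains.
Variables (p : nat) (gT : finGroupType) (g : gT).
Hypothesis p_pr : prime p.
Hypothesis g_gen : <[g]>%g = [set: gT]%SET.
Hypothesis card_gT : #|gT| = p.
Local Notation L := (group_ring (padic p) gT).
Local Notation D := (gr_elt (padic p) g - 1).
Local Notation sc := (gr_scalar gT).
Implicit Types (x y z w : L) (m n : nat).

Let p_gt0 : (0 < p)%N. Proof. exact: prime_gt0. Qed.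
Let mulC := @cyclic_gr_mulC p gT g g_gen.
Let mulCA := @cyclic_gr_mulCA p gT g g_gen.

Lemma aug_norm_p : aug (gr_norm : L) = p%:R.
Proof. by rewrite aug_gr_norm [X in X%:R]card_gT. Qed.

Lemma norm_chain_step y :
  (exists z, gr_norm * y = p%:R * (gr_norm * z)) <-> (exists c, aug y = c *+ p).
Proof.
split=> [[z]|[c augy]]; last first.
  by exists (sc c); rewrite !gr_normM aug_gr_scalar augy gr_scalarMn mulr_natl mulrnAl.
rewrite !gr_normM => /ffunP/(_ 1%g); rewrite mulr_natl ffunMnE !gr_scalarM.
by rewrite ffunE !mulr1 => ->; exists (aug z).
Qed.

Lemma norm_chain_inj y : p%:R * (gr_norm * y) = 0 -> gr_norm * y = 0.
Proof. by rewrite mulr_natl -[X in _ *+ X]expn1 => /(gr_mulpnI p_gt0). Qed.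

Lemma gsub1_kerP x : D * x = 0 <-> exists z, x = gr_norm * z.
Proof.
split=> [/(gsub1_ker g_gen) xE|[z ->]]; last first.
  by rewrite mulrA (gsub1_norm _ g_gen) mul0r.
by exists (sc (x 1%g)); rewrite mulC.
Qed.

Lemma norm_quot_torsfree x m :
  (exists z, x *+ p ^ m = gr_norm * z) -> exists z, x = gr_norm * z.
Proof.
move=> /gsub1_kerP; rewrite mulrnAr => /(gr_mulpnI p_gt0) ?; exact/gsub1_kerP.
Qed.

Lemma aug_kerP x : aug x = 0 <-> exists z, x = D * z.
Proof.
split=> [|[z ->]]; first exact: aug_eq0_gsub1.
by rewrite rmorphM /= aug_gsub1 mul0r.
Qed.

(** The augmentation of y is determined modulo p by (g - 1) y, since y is then
determined up to a multiple of the norm, of augmentation p.  Conversely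
p (g - 1) is a multiple of (g - 1)^2, because the norm is killed by g - 1 and
equals p up to a multiple of g - 1. *)
Lemma gsub1_chain_step y :
  (exists z, D * y = D * (D * z)) <-> (exists c, aug y = c *+ p).
Proof.
split=> [[z Dy]|[c augy]].
  have /gsub1_kerP[u uE] : D * (y - D * z) = 0 by rewrite mulrBr Dy subrr.
  exists (aug u); rewrite -(subrK (D * z) y) uE rmorphD !rmorphM /= aug_gsub1.
  by rewrite mul0r addr0 aug_norm_p mulr_natl.
have [z yE] := aug_decomp g_gen y.
have [u normE] := @norm_decomp p gT g g_gen card_gT.
have Dp : D *+ p = - (D * (D * u)).
  by apply/eqP; rewrite -addr_eq0 -mulr_natr -mulrDr -normE (gsub1_norm _ g_gen).
exists (z - u * sc c).
rewrite {1}yE augy gr_scalarMn mulrDr mulrnAr -mulrnAl Dp.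
by rewrite !mulrBr mulNr !mulrA addrC.
Qed.

(** A fixed point in the augmentation ideal is a multiple c of the norm of
augmentation c p = 0. *)
Lemma gsub1_chain_inj y : D * (D * y) = 0 -> D * y = 0.
Proof.
move=> /(gsub1_ker g_gen); set c := (X in sc X) => DyE.
suff c0 : c = 0 by rewrite DyE c0 (gr_scalar_nat _ _ 0) mul0r.
apply: (@padic_mulpnI p p_gt0 1); rewrite expn1.
have := congr1 (@aug (padic p) gT) DyE; rewrite !rmorphM /= aug_gsub1 mul0r.
by rewrite aug_gr_scalar aug_norm_p mulr_natr => <-.
Qed.

Lemma gsub1_quot_torsfree x m :
  (exists z, x *+ p ^ m = D * z) -> exists z, x = D * z.
Proof.
by move=> /aug_kerP; rewrite rmorphMn /= => /(padic_mulpnI p_gt0)/aug_kerP.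
Qed.

Lemma mem_fixed_points x : x \in fixed_points L^o <-> exists z, x = gr_norm * z.
Proof.
rewrite -gsub1_kerP; split=> [/forallP/(_ g)/eqP gx|Dx].
  by rewrite mulrBl mul1r; apply/eqP; rewrite subr_eq0; apply/eqP.
apply/forallP => h; apply/eqP/ffunP => k.
have xE := gsub1_ker g_gen Dx.
by rewrite -[LHS]/((gr_elt (padic p) h * x) k) gr_eltM xE !gr_scalarM !ffunE.
Qed.

Lemma mem_aug_ideal x : x \in aug_ideal (padic p) gT <-> exists z, x = D * z.
Proof. by rewrite -aug_kerP; split=> /eqP. Qed.

(** Modulo p^k, each of the finitely many coefficients of an element of the group
ring takes finitely many values. *)
Lemma finite_of_exponent (A : lmodType L) (a : A) k :
  (forall b : A, exists x, b = x *: a) -> (p ^ k)%:R *: a = 0 ->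
  finite_set [set: A]%classic.
Proof.
move=> a_gen pka0.
pose r (f : {ffun gT -> 'I_(p ^ k)}) : L := [ffun h => (f h : nat)%:R].
apply: (@sub_finite_set _ _ [set r f *: a | f in setT]%classic); last first.
  exact/finite_image/finite_finset.
move=> b _; have [x ->] := a_gen b.
have digits h : exists i : 'I_(p ^ k), exists c, x h = (i : nat)%:R + c *+ p ^ k.
  by have [i i_lt] := padic_approx p_gt0 (x h) k; exists (Ordinal i_lt).
have [f fP] := choice digits; have [c cP] := choice fP.
exists (finfun f) => //.
have -> : x = r (finfun f) + ([ffun h => c h] : L) * (p ^ k)%:R.
  by apply/ffunP => h; rewrite mulr_natr !ffunE ffunMnE !ffunE.
by rewrite scalerDl -scalerA pka0 scaler0 addr0.
Qed.

End TwoChains.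


(** * Classification of the infinite cyclic modules *)

(** All the isomorphisms with A are obtained from two surjections of the regular
module with the same kernel, here without forming the quotient by it. *)
Lemma lmod_iso_of_ker (R : pzRingType) (U V W : lmodType R)
    (f : U -> V) (h : U -> W) :
    linear f -> linear h ->
    (forall v, exists u, v = f u) -> (forall w, exists u, w = h u) ->
    (forall u, f u = 0 <-> h u = 0) ->
  lmod_iso V W.
Proof.
move=> f_lin h_lin f_onto h_onto ker.
pose fL : {linear U -> V} := HB.pack f (GRing.isLinear.Build R U V *:%R f f_lin).
pose hL : {linear U -> W} := HB.pack h (GRing.isLinear.Build R U W *:%R h h_lin).
have fh u u' : f u = f u' <-> h u = h u'.
  split=> /eqP; rewrite -subr_eq0.
    rewrite -[f u - f u']/(fL u - fL u') -raddfB => /eqP/ker.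
    by rewrite -[h _]/(hL _) raddfB => /eqP; rewrite subr_eq0 => /eqP.
  rewrite -[h u - h u']/(hL u - hL u') -raddfB => /eqP/ker.
  by rewrite -[f _]/(fL _) raddfB => /eqP; rewrite subr_eq0 => /eqP.
have [s sP] := choice f_onto; have [r rP] := choice h_onto.
have hs_lin : linear (h \o s).
  by move=> b v v' /=; rewrite -h_lin; apply/fh; rewrite f_lin -!sP.
pose hs : {linear V -> W} :=
  HB.pack (h \o s) (GRing.isLinear.Build R V W *:%R (h \o s) hs_lin).
exists hs, (f \o r) => [v|w] /=; last by rewrite [RHS]rP; apply/fh; rewrite -sP.
by rewrite [RHS]sP; apply/fh; rewrite -rP.
Qed.

Section CyclicModules.
Variables (p : nat) (gT : finGroupType) (g : gT).
Hypothesis p_pr : prime p.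
Hypothesis g_gen : <[g]>%g = [set: gT]%SET.
Hypothesis card_gT : #|gT| = p.
Local Notation L := (group_ring (padic p) gT).
Local Notation D := (gr_elt (padic p) g - 1).
Implicit Types (x y z w : L) (m n : nat).

Let p_gt0 : (0 < p)%N. Proof. exact: prime_gt0. Qed.
Let mulC := @cyclic_gr_mulC p gT g g_gen.
Let mulCA := @cyclic_gr_mulCA p gT g g_gen.
Let augp : exists c, aug (p%:R : L) = c *+ p.
Proof. by exists 1; rewrite rmorph_nat. Qed.
Let augD : exists c, aug D = c *+ p.
Proof. by exists 0; rewrite aug_gsub1 mul0rn. Qed.

Variables (A : lmodType L) (a : A).
Hypothesis a_gen : forall b : A, exists x, b = x *: a.

(** If the annihilator contains some y not fixed by g and some x of nonzero
augmentation, then it contains (g - 1) y and norm x, hence by [chain_exponent]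
multiples of g - 1 and of the norm by powers of p, hence a power of p, and A is
finite. *)
Lemma infinite_annihilator : infinite_set [set: A]%classic ->
  [\/ forall x, x *: a = 0 -> x = 0,
      exists n, forall x, x *: a = 0 <-> exists z, x = p%:R ^+ n * (gr_norm * z)
    | exists n, forall x, x *: a = 0 <-> exists z, x = D ^+ n * (D * z)].
Proof.
move=> A_inf; pose K x := x *: a = 0.
have KM r x : K x -> K (r * x) by rewrite /K -scalerA => ->; rewrite scaler0.
have K0 : K 0 by exact: scale0r.
have [|/existsNP[x0 /not_implyP[Kx0 x0_neq0]]] := pselect (forall x, K x -> x = 0).
  by constructor 1.
have K_neq0 : exists2 x, K x & x <> 0 by exists x0.
have [K_norm|/existsNP[y /not_implyP[Ky Dy]]] :=
  pselect (forall x, K x -> exists z, x = gr_norm * z).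
  constructor 2; apply: (chain_ideal p_pr g_gen card_gT augp _ KM K_norm K0 K_neq0).
  exact: norm_chain_step.
have [K_D|/existsNP[x /not_implyP[Kx augx]]] :=
  pselect (forall x, K x -> exists z, x = D * z).
  constructor 3; apply: (chain_ideal p_pr g_gen card_gT augD _ KM K_D K0 K_neq0).
  exact: gsub1_chain_step.
case: A_inf.
have [n Kn] : exists n, K (gr_norm *+ p ^ n).
  apply: (chain_exponent p_pr g_gen card_gT augp (@norm_chain_step p gT) KM K0).
  exists x; first exact: KM.
  rewrite gr_normM => /ffunP/(_ 1%g); rewrite gr_scalarM !ffunE mulr1.
  by move=> /(aug_kerP g_gen).
have [m Km] : exists m, K (D *+ p ^ m).
  apply: (chain_exponent p_pr g_gen card_gT augD (gsub1_chain_step g_gen card_gT) KM K0).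
  by exists y; [exact: KM|move=> /(gsub1_kerP g_gen)].
have [z zE] := @norm_decomp p gT g g_gen card_gT.
apply: (@finite_of_exponent p gT p_pr A a (m + n + 1)%N a_gen).
have -> : (p ^ (m + n + 1))%:R = (p ^ m)%:R * (gr_norm *+ p ^ n)
   - z * (p ^ n)%:R * (D *+ p ^ m) :> L.
  rewrite -[gr_norm *+ _]mulr_natr -[D *+ _]mulr_natl zE mulrDl mulrDr.
  rewrite [z * _ * _]mulC -!mulrA addrK -!natrM; congr (_%:R).
  by rewrite !expnD expn1 [(p * _)%N]mulnC mulnA.
by rewrite scalerBl -!scalerA Kn Km !scaler0 subr0.
Qed.

Lemma scale_generator_is_linear : linear (fun x : L^o => x *: a).
Proof. by move=> r x y; rewrite scalerDl scalerA. Qed.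

Lemma lmod_iso_quotmod (N : submodClosed L^o) :
  (forall x : L^o, x *: a = 0 <-> x \in N) -> lmod_iso A (quotmod N).
Proof.
move=> ann_N.
apply: (lmod_iso_of_ker scale_generator_is_linear (@pi_quotmod_is_linear _ _ N)) => //.
  exact: pi_quotmod_surj.
by move=> x; rewrite ann_N -{1}[x]subr0 -pi_quotmodP raddf0.
Qed.

Lemma lmod_iso_free : (forall x, x *: a = 0 -> x = 0) -> lmod_iso A L^o.
Proof.
move=> a_free.
apply: (lmod_iso_of_ker scale_generator_is_linear (h := @idfun L^o)) => // [w|x].
  by exists w.
by split=> [/a_free //|/= ->]; rewrite scale0r.
Qed.

Lemma torsion_free :
  (forall x, x *: a = 0 -> x = 0) -> torsion p A = [set 0]%classic.
Proof.
move=> a_free; apply/seteqP; split=> [b [l l_gt0]|_ ->]; last first.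
  by exists 1%N => //; rewrite mul0rn.
have [x ->] := a_gen b.
by rewrite scalerMnl => /a_free/(gr_mulpnI p_gt0) ->; rewrite scale0r.
Qed.

(** Multiplication by g - 1 maps the regular module onto the augmentation ideal,
with kernel the fixed points. *)
Lemma lmod_iso_aug_ideal :
  (forall x, x *: a = 0 <-> exists z, x = gr_norm * z) ->
  lmod_iso A (submod (aug_ideal (padic p) gT)).
Proof.
move=> annE.
have D_aug (x : L^o) : (D * x : L^o) \in aug_ideal (padic p) gT.
  by apply/(mem_aug_ideal g_gen); exists x.
pose h (x : L^o) : submod (aug_ideal (padic p) gT) := Submod (D_aug x).
have h_lin : linear h.
  move=> r x y; apply: val_inj => /=; rewrite mulrDr; congr (_ + _).
  by rewrite -[r *: x]/(r * x : L) mulCA.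
apply: (lmod_iso_of_ker scale_generator_is_linear h_lin) => //.
  move=> [w w_aug]; have [x wE] := (mem_aug_ideal g_gen w).1 w_aug.
  by exists x; apply: val_inj.
move=> x; rewrite annE -(gsub1_kerP g_gen).
by split=> [Dx|/(congr1 val)//]; apply: val_inj.
Qed.

Lemma lmod_iso_trivial :
  (forall x, x *: a = 0 <-> exists z, x = D * z) ->
  lmod_iso A (trivial_module (padic p)).
Proof.
move=> annE.
pose h (x : L^o) : trivial_module (padic p) := aug x.
have h_lin : linear h.
  by move=> r x y; rewrite /h raddfD /= -[r *: x]/(r * x : L) rmorphM.
apply: (lmod_iso_of_ker scale_generator_is_linear h_lin) => //.
  by move=> c; exists (gr_scalar gT c); rewrite /h aug_gr_scalar.
by move=> x; rewrite annE -(aug_kerP g_gen).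
Qed.

Lemma card_trivial_torsion n :
  torsion p A = [set 0]%classic -> (torsion p A #= `I_(p ^ n))%card -> n = 0%N.
Proof.
move=> ->; case: n => // n.
have /card_eq_trans eq1 : (`I_1 #= [set (0 : A)]%classic)%card.
  by rewrite II1 eq_card1.
move=> /eq1/card_eq_II p1; suff : (1 < p ^ n.+1)%N by rewrite -p1.
by rewrite -(expn0 p) ltn_exp2l ?prime_gt1.
Qed.

End CyclicModules.

Theorem theorem3p1 (p : nat) (gT : finGroupType) (g : gT)
    (A : lmodType (group_ring (padic p) gT)) :
  prime p -> <[g]>%g = [set: gT]%SET -> #|gT| = p ->
  infinite_set [set: A]%classic -> cyclic_module A ->
  (torsion p A = [set 0]%classic ->
     [\/ lmod_iso A (group_ring (padic p) gT)^o,
         lmod_iso A (submod (aug_ideal (padic p) gT))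
       | lmod_iso A (trivial_module (padic p))]) /\
  (torsion p A <> [set 0]%classic ->
     exists n : nat,
       (torsion p A #= `I_(p ^ n))%card /\
       (lmod_iso A (quotmod (scale_submod
          (fixed_points (group_ring (padic p) gT)^o) (p ^ n)%:R)) \/
        lmod_iso A (quotmod (scale_submod
          (aug_ideal (padic p) gT) ((gr_elt (padic p) g - 1) ^+ n))))).
Proof.
move=> p_pr g_gen card_gT A_inf /cyclic_moduleP[a a_gen].
have mulC := @cyclic_gr_mulC p gT g g_gen.
have [a_free|[n annE]|[n annE]] :=
  infinite_annihilator p_pr g_gen card_gT a_gen A_inf.
- split=> [_|[]]; last exact: torsion_free a_free.
  by constructor 1; apply: lmod_iso_free a_free.
- have cardT := card_chain_torsion p_pr g_gen (@norm_chain_step p gT)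
    (@norm_chain_inj p gT p_pr) a_gen (@norm_quot_torsfree p gT g p_pr g_gen) annE.
  split=> [T0|_].
    constructor 2; apply: (lmod_iso_aug_ideal g_gen a_gen) => x.
    by rewrite annE (card_trivial_torsion p_pr T0 cardT); split=> -[z ->];
      exists z; rewrite mul1r.
  exists n; split=> //; left; apply: (lmod_iso_quotmod a_gen) => x.
  rewrite annE -natrX scale_submodE; last by move=> b; apply: mulC.
  split=> [[z ->]|[y /(mem_fixed_points g_gen)[z ->] ->]]; last by exists z.
  by exists (gr_norm * z) => //; apply/(mem_fixed_points g_gen); exists z.
- have cardT := card_chain_torsion p_pr g_gen (gsub1_chain_step g_gen card_gT)
    (@gsub1_chain_inj p gT g p_pr g_gen card_gT) a_gen
    (@gsub1_quot_torsfree p gT g p_pr g_gen) annE.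
  split=> [T0|_].
    constructor 3; apply: (lmod_iso_trivial g_gen a_gen) => x.
    by rewrite annE (card_trivial_torsion p_pr T0 cardT); split=> -[z ->];
      exists z; rewrite mul1r.
  exists n; split=> //; right; apply: (lmod_iso_quotmod a_gen) => x.
  rewrite annE scale_submodE; last by move=> b; apply: mulC.
  split=> [[z ->]|[y /(mem_aug_ideal g_gen)[z ->] ->]]; last by exists z.
  exists ((gr_elt (padic p) g - 1) * z) => //.
  by apply/(mem_aug_ideal g_gen); exists z.
Qed.
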